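(* Let $n\ge 1$ and let $u:\mathbb{R}^n\to\mathbb{R}$ be a smooth function defined on all of $\mathbb{R}^n$. The graph $\Sigma=\{(\mathbf{x},u(\mathbf{x})):\mathbf{x}\in\mathbb{R}^n\}$ is a weighted minimal hypersurface of $\mathbb{G}^n\times\mathbb{R}$ if and only if $\Sigma$ is a hyperplane $\{x_{n+1}=a\}$ for some $a\in\mathbb{R}$, i.e. if and only if $u$ is constant.
   Context: Gauss space $\mathbb{G}^n$ is Euclidean space $\mathbb{R}^n$ with the Gaussian probability density $(2\pi)^{-n/2}e^{-|\mathbf{x}|^2/2}$. The product $\mathbb{G}^n\times\mathbb{R}$ is $\mathbb{R}^{n+1}=\mathbb{R}^n\times\mathbb{R}$, with points $(\mathbf{x},x_{n+1})$, $\mathbf{x}=(x_1,\dots,x_n)$, with the Euclidean metric and the density $e^{-f}=(2\pi)^{-n/2}e^{-|\mathbf{x}|^2/2}$, which does not depend on $x_{n+1}$; thus $\nabla f=(x_1,\dots,x_n,0)$. The weighted mean curvature of a hypersurface with unit normal field $\mathbf{n}$ is $H_f=H+\langle\nabla f,\mathbf{n}\rangle$, where $H$ is the Euclidean mean curvature (sum of the principal curvatures, with the sign convention $H=-\operatorname{div}\mathbf{n}$, so that $H_f=0$ is the critical-point equation of the weighted area $\int e^{-f}\,dA$). The hypersurface is called weighted minimal (or $f$-minimal) if $H_f=0$ everywhere. For the graph of $u$ this is the equation $\operatorname{div}\!\left(\frac{\nabla u}{\sqrt{1+|\nabla u|^2}}\right)=\frac{\langle\mathbf{x},\nabla u\rangle}{\sqrt{1+|\nabla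 u|^2}}$ on $\mathbb{R}^n$. *)

(* Defs.v *)
From HB Require Import structures.
From mathcomp Require Import all_boot all_order all_algebra.
From mathcomp Require Import all_classical all_reals all_analysis.

Set Implicit Arguments.
Unset Strict Implicit.
Unset Printing Implicit Defensive.

Import Order.TTheory GRing.Theory Num.Theory.
Import numFieldNormedType.Exports.

Local Open Scope classical_set_scope.
Local Open Scope ring_scope.

(* The library norm on row vectors is the sup norm (it only matters here for
   the topology); Euclidean geometry goes through this inner product. *)
Definition dot (R : realType) (m : nat) (v w : 'rV[R]_m) : R :=
  \sum_(i < m) v 0 i * w 0 i.

Definition grad (R : realType) (m : nat) (F : 'rV[R]_m -> R) (p : 'rV[R]_m) :
  'rV[R]_m := \row_i 'D_(delta_mx 0 i) F p.

(* C^infinity on an open set U: every iterated directional derivative of F, of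
   any order, is (Frechet) differentiable, hence continuous, on U. *)
Definition smooth_on (R : realType) (V W : normedModType R) (U : set V)
    (F : V -> W) : Prop :=
  forall (s : seq V) (p : V), U p ->
    differentiable (foldr (fun v G => 'D_v G) F s) p.

(* Smooth embedded hypersurface of R^m (dimension m - 1): locally a regular
   level set. *)
Definition hypersurface (R : realType) (m : nat) (S : set 'rV[R]_m) : Prop :=
  forall p, S p -> exists (U : set 'rV[R]_m) (F : 'rV[R]_m -> R),
    [/\ open U, U p, smooth_on U F,
        forall q, U q -> grad F q != 0 &
        S `&` U = [set q | U q /\ F q = 0]].

(* v is the velocity at p of a curve lying in S. *)
Definition tangent (R : realType) (m : nat) (S : set 'rV[R]_m)
    (p v : 'rV[R]_m) : Prop :=
  exists c : R -> 'rV[R]_m,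
    [/\ c 0 = p, \forall t \near (0 : R), S (c t) & is_derive (0 : R) 1 c v].

(* Unit normal field of S on the open set U.  As usual for smooth fields along
   an embedded submanifold, N is given by a smooth extension to U; away from S
   it is unconstrained. *)
Definition unit_normal_on (R : realType) (m : nat) (S U : set 'rV[R]_m)
    (N : 'rV[R]_m -> 'rV[R]_m) : Prop :=
  smooth_on U N /\
  forall q, S q -> U q ->
    dot (N q) (N q) = 1 /\ forall v, tangent S q v -> dot (N q) v = 0.

(* Matrix, acting on row vectors, of the orthogonal projection onto the
   hyperplane orthogonal to the unit vector w. *)
Definition proj_orth (R : realType) (m : nat) (w : 'rV[R]_m) : 'M[R]_m :=
  1%:M - w^T *m w.

(* v |-> - D_{v'} N with v' the tangential part of v.  On the tangent space this
   is the shape operator, whose eigenvalues are the principal curvatures, and it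
   vanishes on the normal line.  It depends only on N restricted to S. *)
Definition shape_operator (R : realType) (m : nat)
    (N : 'rV[R]_m -> 'rV[R]_m) (p : 'rV[R]_m) : 'M[R]_m :=
  proj_orth (N p) *m (- 'J N p).

(* H = sum of the principal curvatures = - div_S N, where div_S is the
   divergence along the hypersurface. *)
Definition mean_curvature (R : realType) (m : nat)
    (N : 'rV[R]_m -> 'rV[R]_m) (p : 'rV[R]_m) : R :=
  \tr (shape_operator N p).

Definition weighted_mean_curvature (R : realType) (m : nat)
    (f : 'rV[R]_m -> R) (N : 'rV[R]_m -> 'rV[R]_m) (p : 'rV[R]_m) : R :=
  mean_curvature N p + dot (grad f p) (N p).

(* H_f = 0 at every point, for a unit normal field defined near that point; the
   condition does not depend on the choice of the field, since replacing N by
   - N changes the sign of H_f. *)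
Definition weighted_minimal (R : realType) (m : nat) (f : 'rV[R]_m -> R)
    (S : set 'rV[R]_m) : Prop :=
  hypersurface S /\
  forall p, S p -> exists (U : set 'rV[R]_m) (N : 'rV[R]_m -> 'rV[R]_m),
    [/\ open U, U p, unit_normal_on S U N & weighted_mean_curvature f N p = 0].

Definition gauss_density (R : realType) (n : nat) (x : 'rV[R]_n) : R :=
  (2 * pi) `^ (- (n%:R / 2)) * expR (- (dot x x / 2)).

(* Points of R^n x R are p : 'rV_(n + 1), with x = lsubmx p and
   x_{n+1} = rsubmx p 0 0. *)
Definition gauss_line_density (R : realType) (n : nat) (p : 'rV[R]_(n + 1)) :
  R := gauss_density (lsubmx p).

(* The f of the density e^{-f}. *)
Definition gauss_line_potential (R : realType) (n : nat)
  (p : 'rV[R]_(n + 1)) : R := - ln (gauss_line_density p).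

Definition graph (R : realType) (n : nat) (u : 'rV[R]_n -> R) :
  set 'rV[R]_(n + 1) := range (fun x => row_mx x (const_mx (u x))).

Definition horizontal_hyperplane (R : realType) (n : nat) (a : R) :
  set 'rV[R]_(n + 1) := [set p | rsubmx p 0 0 = a].

(* Main.v *)
Require Import Defs.
From mathcomp Require Import all_boot all_order all_algebra.
From mathcomp Require Import all_classical all_reals all_analysis.
From mathcomp Require Import ring lra.
Set Implicit Arguments.
Unset Strict Implicit.
Unset Printing Implicit Defensive.
Import Order.TTheory GRing.Theory Num.Theory.
Import numFieldNormedType.Exports.
Local Open Scope classical_set_scope.
Local Open Scope ring_scope.

(** The implication that needs work is that an entire weighted minimal graph is
flat.  It is proved by a maximum principle, without integration.

Write p for the gradient of u, H for its Hessian, s = 1 + |p|^2 and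
nu = 1 / sqrt s, the vertical coordinate of the upward unit normal.  In
coordinates, being weighted minimal is the equation
s (tr H - <x, p>) = H(p, p) ([weighted_minimal_graph_equation]).  Geometrically,
nu is a Jacobi function: for the drift Laplacian L of the graph,
L nu = - (|A|^2 + |n_x|^2) nu, where A is the second fundamental form and n_x the
horizontal part of the normal, of square norm 1 - nu^2; the term |n_x|^2 is the
Hessian of |x|^2 / 2 on n_x.  On the other hand L |x|^2 is at most
2 n - 2 |x|^2, because the equation turns the mean curvature into the drift.

So let c > 0.  The function nu + c |x|^2 is proper and attains its minimum, at
some point where L of it is nonnegative.  This forces |x|^2 <= n and
|p|^2 <= 2 c n / nu^3 there ([barrier_minimum_bound]).  The minimum points stay
in a fixed ball, on which nu is bounded below by some m > 0; hence nu at the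
minimum point is at least 1 - |p|^2 >= 1 - 2 c n / m^3, and everywhere
nu + c |x|^2 >= 1 - 2 c n / m^3.  Letting c tend to 0 gives nu >= 1, that is,
p = 0 ([vnormal_eq1]).

The computation of L nu is carried out at the minimum point only: the second
derivative test in every direction ([derive2_min]) gives an inequality between
quadratic forms, which is traced against the inverse metric of the graph by
means of the elementary [qform_le_trace], and compared with the derivative of
the minimal graph equation along p ([derived_minimal_graph_equation]).  The
nonnegativity of |A|^2 is [graph_curvature_ge0].

For the equation itself, differentiating the orthogonality of the normal field N
to the coordinate tangent vectors along curves of the graph expresses the shape
operator on tangent vectors through the Hessian of u ([shape_on_tangents]); the
trace defining the mean curvature is then computed by writing the projection
onto the tangent space in the basis of these vectors ([projection_tangent]). *)

(** * Calculus along lines *)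

Section DirectionalCalculus.
Context {R : realType} {V : normedModType R}.
Implicit Types (F G : V -> R) (x v w : V).

Lemma is_derive_lineP F x v (t : R) d :
  is_derive (x + t *: v) v F d <-> is_derive t 1 (fun r : R => F (x + r *: v)) d.
Proof.
have E : (fun h : R => h^-1 *: (((fun r : R => F (x + r *: v)) \o shift t) (h *: 1)
            - F (x + t *: v)))
         = (fun h : R => h^-1 *: ((F \o shift (x + t *: v)) (h *: v) - F (x + t *: v))).
  apply/funext => h /=; congr (_ *: (F _ - _)).
  by rewrite scalerDl /GRing.scale /= mulr1 addrCA.
split=> -[Hd He]; split.
- by rewrite /derivable E.
- by rewrite /derive E.
- by rewrite /derivable -E.
- by rewrite /derive -E.
Qed.

Lemma is_derive_line F x v (t : R) d :
  is_derive (x + t *: v) v F d -> is_derive t 1 (fun r : R => F (x + r *: v)) d.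
Proof. by move/is_derive_lineP. Qed.

Lemma line_is_derive F x v (t : R) d :
  is_derive t 1 (fun r : R => F (x + r *: v)) d -> is_derive (x + t *: v) v F d.
Proof. by move/is_derive_lineP. Qed.

(** The differentiation rules are restated for functions given by explicit formulas,
so that they compose by unification with the expressions differentiated below. *)
Lemma is_derive_sumf (I : finType) (h : I -> V -> R) x v (dh : I -> R) :
  (forall i, is_derive x v (h i) (dh i)) ->
  is_derive x v (fun y => \sum_i h i y) (\sum_i dh i).
Proof.
move=> H; rewrite (_ : (fun _ => _) = \sum_i h i); last first.
  by apply/funext => y; rewrite fct_sumE.
elim/big_ind2 : _ => [|f df g dg Hf Hg|i _]; last exact: H.
  exact: is_derive_cst.
exact: is_deriveD.
Qed.

Lemma is_derive_mul F G x v dF dG : is_derive x v F dF -> is_derive x v G dG ->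
  is_derive x v (fun y => F y * G y) (dF * G x + F x * dG).
Proof.
move=> HF HG; apply: (@is_derive_eq _ _ _ (F * G)).
by rewrite /GRing.scale /= addrC mulrC.
Qed.

Lemma is_derive_add F G x v dF dG : is_derive x v F dF -> is_derive x v G dG ->
  is_derive x v (fun y => F y + G y) (dF + dG).
Proof. by move=> HF HG; apply: (@is_derive_eq _ _ _ (F + G)). Qed.

Lemma is_derive_scale (a : R) F x v dF : is_derive x v F dF ->
  is_derive x v (fun y => a * F y) (a * dF).
Proof. by move=> HF; apply: (@is_derive_eq _ _ _ (a *: F)). Qed.

Lemma is_derive_comp1 (g : R -> R) F x v dg dF :
  is_derive (F x) 1 g dg -> is_derive x v F dF ->
  is_derive x v (fun y => g (F y)) (dg * dF).
Proof.
have -> : x = x + (0 : R) *: v by rewrite scale0r addr0.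
move=> Hg HF; apply: line_is_derive.
by apply: (@is_derive1_comp _ g (fun r : R => F (x + r *: v))) => //; exact: is_derive_line.
Qed.

Lemma mean_value_line F x v (h : R) : 0 < h ->
  (forall y, derivable F y v) ->
  exists2 c, 0 < c < h & F (x + h *: v) - F x = h * 'D_v F (x + c *: v).
Proof.
move=> h0 dF.
have dg (t : R) : is_derive t 1 (fun r : R => F (x + r *: v)) ('D_v F (x + t *: v)).
  by apply/is_derive_line/derivableP/dF.
have [|c] := MVT h0 (fun t _ => dg t).
  apply: derivable_within_continuous => t _.
  by have [] := dg t.
rewrite in_itv /= scale0r addr0 subr0 => ch E.
by exists c => //; rewrite E mulrC.
Qed.

Lemma derive_min F x v : (forall y, F x <= F y) -> (forall y, derivable F y v) ->
  'D_v F x = 0.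
Proof.
move=> Fmin dF.
have := @is_derive_line F x v 0 ('D_v F x).
rewrite scale0r addr0 => /(_ (derivableP (dF x))) [_ <-].
have dg (t : R) : is_derive t 1 (fun r : R => F (x + r *: v)) ('D_v F (x + t *: v)).
  by apply/is_derive_line/derivableP/dF.
have [] // := @derive1_at_min R (fun r : R => F (x + r *: v)) (-1) 1 0.
- by rewrite in_itv /= ltrN10 ltr01.
- by move=> t _; rewrite scale0r addr0.
Qed.

(** If the second derivative were negative, the first one, which vanishes at the
minimum, would be negative just after it along v; the mean value theorem would
then produce a smaller value. *)
Lemma derive2_min F x v : (forall y, F x <= F y) -> (forall y, derivable F y v) ->
  derivable ('D_v F) x v -> 0 <= 'D_v ('D_v F) x.
Proof.
move=> Fmin dF ddF; rewrite leNgt; apply/negP => lt0.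
have D0 := derive_min Fmin dF.
have : ('D_v F \o shift x) (h *: v) / h @[h --> (0:R)^'] --> 'D_v ('D_v F) x.
  rewrite /derive.
  have := ddF; rewrite /derivable -/(derive _ _ _) D0.
  under eq_fun do rewrite subr0 /GRing.scale /= mulrC.
  by [].
move=> /(@cvgr_lt _ _ _ _ _ _) => /(_ _ lt0).
move=> /nbhs_ballP [e /= e0 He].
have [c /andP[c0 ce] E] := @mean_value_line F x v (e / 2) (divr_gt0 e0 (ltr0Sn _ _)) dF.
have : F x <= F (x + (e / 2) *: v) by [].
rewrite -subr_ge0 E pmulr_rge0 ?divr_gt0// leNgt => /negP; apply.
have := He c; rewrite /= /ball /= sub0r normrN gtr0_norm// => /(_ _ _).
rewrite pmulr_llt0 ?invr_gt0// addrC; apply; last by rewrite gt_eqF.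
by rewrite (lt_trans ce) // ltr_pdivrMr // ltr_pMr // ltr1n.
Qed.

(** Two applications of the mean value theorem.  The left-hand side is symmetric in
v and w, which is what makes mixed derivatives commute. *)
Lemma second_difference F x v w (h : R) : 0 < h ->
  (forall y, derivable F y v) -> (forall y, derivable ('D_v F) y w) ->
  exists c c', [/\ 0 < c < h, 0 < c' < h &
    F (x + h *: v + h *: w) - F (x + h *: v) - F (x + h *: w) + F x =
    h * (h * 'D_w ('D_v F) (x + c *: v + c' *: w))].
Proof.
move=> h0 dF ddF.
pose G y := F (y + h *: w) - F y.
have dG y : is_derive y v G ('D_v F (y + h *: w) - 'D_v F y).
  apply: is_deriveB; last exact/derivableP/dF.
  have := derivableP (dF (y + h *: w)).
  have E : (fun k : R => k^-1 *: (((fun z => F (z + h *: w)) \o shift y) (k *: v)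
            - F (y + h *: w)))
         = (fun k : R => k^-1 *: ((F \o shift (y + h *: w)) (k *: v) - F (y + h *: w))).
    by apply/funext => k /=; rewrite addrA.
  by move=> [Hd He]; split; [rewrite /derivable E|rewrite /derive E].
have [|c ch E] := @mean_value_line G x v h h0.
  by move=> y; have [] := dG y.
have [c' ch' E'] := @mean_value_line ('D_v F) (x + c *: v) w h h0 ddF.
exists c, c'; split => //; rewrite -E'.
have [_ <-] := dG (x + c *: v).
by rewrite -E /G; ring.
Qed.

Lemma derive_comm F x v w :
  (forall y, derivable F y v) -> (forall y, derivable F y w) ->
  (forall y, derivable ('D_v F) y w) -> (forall y, derivable ('D_w F) y v) ->
  {for x, continuous ('D_w ('D_v F))} -> {for x, continuous ('D_v ('D_w F))} ->
  'D_w ('D_v F) x = 'D_v ('D_w F) x.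
Proof.
move=> dv dw dvw dwv cvw cwv; apply/eqP; rewrite -subr_eq0 -normr_le0.
apply/ler_addgt0Pl => e e0; rewrite addr0.
have e2 : 0 < e / 2 by rewrite divr_gt0.
have /cvgrPdist_lt/(_ _ e2) := cvw; have /cvgrPdist_lt/(_ _ e2) := cwv.
move=> /nbhs_normP[d1 /= d10 H1] /nbhs_normP[d2 /= d20 H2].
have [d [d0 dd1 dd2]] : exists d : R, [/\ 0 < d, d <= d1 & d <= d2].
  by exists (Num.min d1 d2); rewrite lt_min d10 !ge_min !lexx orbT.
(* Every point x + c v + c' w with 0 < c, c' < h is then at distance less than d
   from x; the summand 1 keeps the denominator positive. *)
pose h : R := d / (1 + `|v| + `|w|).
have N0 : 0 < 1 + `|v| + `|w| by rewrite -addrA ltr_pwDl// addr_ge0.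
have h0 : 0 < h by rewrite divr_gt0.
have near_x c c' : 0 < c < h -> 0 < c' < h -> `|x - (x + c *: v + c' *: w)| < d.
  move=> /andP[c0 ch] /andP[c'0 c'h].
  rewrite -addrA opprD addrA subrr sub0r normrN (le_lt_trans (ler_normD _ _))//.
  rewrite !normrZ !gtr0_norm// (@le_lt_trans _ _ (h * `|v| + h * `|w|))//.
    by rewrite lerD// ler_wpM2r// ltW.
  rewrite -mulrDr /h mulrAC ltr_pdivrMr// ltr_pM2l// -addrA ltrDr//.
move: h h0 near_x => {N0} h h0 near_x.
have [c [c' [hc hc' E]]] := second_difference x h0 dv dvw.
have [b [b' [hb hb' E']]] := second_difference x h0 dw dwv.
have {E E'}E : 'D_w ('D_v F) (x + c *: v + c' *: w) =
  'D_v ('D_w F) (x + b *: w + b' *: v).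
  have h1 : h != 0 by rewrite gt_eqF.
  apply: (mulfI h1); apply: (mulfI h1).
  apply: etrans (esym E) (etrans _ E').
  by congr (_ + _); rewrite addrAC (addrAC x).
have A1 : `|'D_v ('D_w F) x - 'D_v ('D_w F) (x + b *: w + b' *: v)| < e / 2.
  by apply: H1; apply: lt_le_trans dd1; rewrite addrAC; exact: near_x.
have A2 : `|'D_w ('D_v F) x - 'D_w ('D_v F) (x + c *: v + c' *: w)| < e / 2.
  by apply: H2; apply: lt_le_trans dd2; exact: near_x.
rewrite distrC in A1; rewrite E in A2.
apply: ltW; apply: le_lt_trans (_ : _ <= _) _; last first.
  rewrite (splitr e); exact: ltrD A2 A1.
by apply: le_trans (ler_normD _ _); rewrite addrA subrK.
Qed.

End DirectionalCalculus.

(** * Quadratic forms *)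

Section Algebra.
Context {R : realType} {n : nat}.
Implicit Types (A H : 'I_n -> 'I_n -> R) (p v w y : 'I_n -> R).

Definition qform A v := \sum_i \sum_j v i * v j * A i j.
Definition ip v w := \sum_i v i * w i.

Lemma sum_delta (k : 'I_n) (f : 'I_n -> R) : \sum_i (i == k)%:R * f i = f k.
Proof.
rewrite (bigD1 k)//= eqxx mul1r big1 ?addr0// => i /negbTE ->.
by rewrite mul0r.
Qed.

Lemma qform_pair A (k l : 'I_n) (a b : R) :
  qform A (fun i => a * (i == k)%:R + b * (i == l)%:R) =
  a ^+ 2 * A k k + a * b * (A k l + A l k) + b ^+ 2 * A l l.
Proof.
have lin (f : 'I_n -> R) :
    \sum_i (a * (i == k)%:R + b * (i == l)%:R) * f i = a * f k + b * f l.
  rewrite -(sum_delta k f) -(sum_delta l f) !mulr_sumr -big_split/=.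
  by apply: eq_bigr => i _; ring.
rewrite /qform; under eq_bigr => i _.
  under eq_bigr => j _ do rewrite -mulrA.
  rewrite -mulr_sumr (lin (fun j => A i j)); over.
rewrite (lin (fun i => a * A i k + b * A i l)); ring.
Qed.

Lemma qform_trace_ge0 A : (forall v, 0 <= qform A v) -> 0 <= \sum_i A i i.
Proof.
move=> psd; apply: sumr_ge0 => i _.
have := psd (fun j => 1 * (j == i)%:R + 0 * (j == i)%:R).
by rewrite qform_pair; congr (0 <= _); ring.
Qed.

(** Averages the form over the vectors p_l e_k - p_k e_l, which span the orthogonal
of p: the sum of the values there is twice the difference of the two sides. *)
Lemma qform_le_trace A p : (forall v, 0 <= qform A v) ->
  qform A p <= ip p p * \sum_i A i i.
Proof.
move=> psd.
have : 0 <= \sum_k \sum_l qform A (fun i => p l * (i == k)%:R + (- p k) * (i == l)%:R).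
  by apply: sumr_ge0 => k _; apply: sumr_ge0 => l _.
have -> : \sum_k \sum_l qform A (fun i => p l * (i == k)%:R + (- p k) * (i == l)%:R) =
  (ip p p * \sum_i A i i - qform A p) *+ 2.
  have E1 : ip p p * \sum_i A i i = \sum_k \sum_l p l ^+ 2 * A k k.
    rewrite mulrC mulr_suml; apply: eq_bigr => k _.
    by rewrite /ip mulr_sumr; apply: eq_bigr => l _; ring.
  have E2 : ip p p * \sum_i A i i = \sum_k \sum_l p k ^+ 2 * A l l.
    rewrite /ip mulr_suml; apply: eq_bigr => k _.
    by rewrite mulr_sumr; apply: eq_bigr => l _; ring.
  have E3 : qform A p = \sum_k \sum_l p k * p l * A l k.
    by rewrite /qform exchange_big; apply: eq_bigr => k _; apply: eq_bigr => l _; ring.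
  rewrite mulr2n {1}E1 E2 {1}E3 /qform -!sumrN -!big_split/=; apply: eq_bigr => k _.
  rewrite -!sumrN -!big_split/=; apply: eq_bigr => l _.
  have := qform_pair A k l (p l) (- p k).
  rewrite /qform => ->; ring.
by rewrite pmulrn_lge0// subr_ge0.
Qed.

Lemma qform_prod v y w : qform (fun i j => y i * w j) v = ip v y * ip v w.
Proof.
rewrite /qform /ip mulr_suml; apply: eq_bigr => i _.
by rewrite mulr_sumr; apply: eq_bigr => j _; ring.
Qed.

Lemma qformD A B v : qform (fun i j => A i j + B i j) v = qform A v + qform B v.
Proof.
rewrite /qform -big_split; apply: eq_bigr => i _.
by rewrite -big_split; apply: eq_bigr => j _; rewrite /=; ring.
Qed.

Lemma qformZ (a : R) A v : qform (fun i j => a * A i j) v = a * qform A v.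
Proof.
rewrite /qform mulr_sumr; apply: eq_bigr => i _.
by rewrite mulr_sumr; apply: eq_bigr => j _; ring.
Qed.

Lemma qform_sum (A : 'I_n -> 'I_n -> 'I_n -> R) v :
  qform (fun i j => \sum_k A k i j) v = \sum_k qform (A k) v.
Proof.
rewrite /qform [RHS]exchange_big; apply: eq_bigr => i _.
by rewrite [RHS]exchange_big; apply: eq_bigr => j _; rewrite mulr_sumr.
Qed.

Lemma qform_diag v : qform (fun i j => (i == j)%:R) v = ip v v.
Proof.
apply: eq_bigr => i _; rewrite -(sum_delta i v) mulr_sumr.
by apply: eq_bigr => j _; rewrite eq_sym; ring.
Qed.

Lemma ip_ge0 v : 0 <= ip v v.
Proof. by apply: sumr_ge0 => i _; rewrite -expr2 sqr_ge0. Qed.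

(** The rank one case of [qform_le_trace]. *)
Lemma cauchy_schwarz v w : ip v w ^+ 2 <= ip v v * ip w w.
Proof.
rewrite expr2 -qform_prod; apply: qform_le_trace => z.
by rewrite qform_prod -expr2 sqr_ge0.
Qed.

Lemma ip_selfadjoint H v w : (forall i j, H i j = H j i) ->
  ip v (fun i => ip w (H i)) = ip w (fun i => ip v (H i)).
Proof.
move=> Hsym; rewrite /ip; under eq_bigr do rewrite mulr_sumr.
rewrite exchange_big; apply: eq_bigr => k _; rewrite mulr_sumr.
by apply: eq_bigr => i _; rewrite Hsym; ring.
Qed.

Lemma qform_second_order H (t : 'I_n -> 'I_n -> 'I_n -> R) p v :
  (forall i j, H i j = H j i) ->
  qform (fun i j => ip (H i) (H j) + ip p (t i j)) v =
  ip (fun i => ip v (H i)) (fun i => ip v (H i))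
    + ip p (fun k => qform (fun i j => t i j k) v).
Proof.
move=> Hsym; rewrite qformD 2!qform_sum; congr (_ + _); apply: eq_bigr => k _.
  by rewrite qform_prod; congr (_ * _); apply: eq_bigr => i _; rewrite Hsym.
by rewrite qformZ.
Qed.

(** The expression is s times the square norm of the second fundamental form of a
graph with gradient p and Hessian H.  It is bounded below by [qform_le_trace] for
the form v |-> a(Hv, Hv), where a is the inverse metric of the graph. *)
Lemma graph_curvature_ge0 H p g (s : R) : (forall i j, H i j = H j i) ->
  s = 1 + ip p p -> (forall i, g i = ip p (H i)) ->
  0 <= s * (\sum_i ip (H i) (H i)) - 2 * ip g g + s^-1 * ip p g ^+ 2.
Proof.
move=> Hsym sE gE.
have s0 : 0 < s by rewrite sE ltr_wpDr// ip_ge0.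
pose A i j := \sum_k H k i * H k j + (- s^-1) * (g i * g j).
have AE v : qform A v = (\sum_k ip v (H k) ^+ 2) - s^-1 * ip v g ^+ 2.
  rewrite qformD qform_sum qformZ qform_prod mulNr expr2; congr (_ - _).
  by apply: eq_bigr => k _; rewrite qform_prod expr2.
have vg v : ip v g = ip p (fun k => ip v (H k)).
  have -> : g = (fun i => ip p (H i)) by exact/funext.
  exact: ip_selfadjoint.
have psd v : 0 <= qform A v.
  rewrite AE subr_ge0 mulrC ler_pdivrMr// vg (le_trans (cauchy_schwarz _ _))//.
  rewrite mulrC {1}/ip; under eq_bigr do rewrite -expr2.
  by rewrite ler_wpM2l ?sumr_ge0// => [i _|]; rewrite ?sqr_ge0// sE lerDr.
have trE : \sum_i A i i = \sum_i ip (H i) (H i) - s^-1 * ip g g.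
  rewrite /A big_split/= -mulr_sumr mulNr; congr (_ - _).
  by rewrite exchange_big; apply: eq_bigr => i _; rewrite -/(ip _ _).
have := qform_le_trace p psd; have := qform_trace_ge0 psd.
rewrite AE trE.
have -> : \sum_k ip p (H k) ^+ 2 = ip g g.
  by apply: eq_bigr => k _; rewrite expr2 gE.
have -> : ip p p = s - 1 by rewrite sE; ring.
move: (\sum_i _) (ip g g) (ip p g) => h gg k.
have -> : (s - 1) * (h - s^-1 * gg) = s * h - gg - (h - s^-1 * gg).
  by field; rewrite gt_eqF.
lra.
Qed.

(** The algebra of the maximum principle.  Here p, H and t stand for the first, second
and third derivatives of u at x, and r for the inverse of the vertical coordinate of
the normal; the hypotheses are the minimal graph equation, its derivative along p,
and the first and second order conditions at a minimum of the barrier.  The last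
hypothesis is traced against the inverse metric by [qform_le_trace]; the derived
equation eliminates the third derivatives, and the first order condition makes the
drift term <x, g> nonnegative. *)
Lemma interior_minimum_bound (x p g : 'I_n -> R) H (t : 'I_n -> 'I_n -> 'I_n -> R)
    (r e : R) : 0 < r -> 0 < e -> r ^+ 2 = 1 + ip p p ->
  (forall i j, H i j = H j i) -> (forall i, g i = ip p (H i)) ->
  r ^+ 2 * (\sum_i H i i - ip x p) = ip p g ->
  2 * ip p g * (\sum_i H i i - ip x p)
    + r ^+ 2 * (\sum_i \sum_k p k * t i i k - ip p p - ip x g)
    = 2 * ip g g + \sum_k p k * qform (fun i j => t i j k) p ->
  (forall i, g i = 2 * e * r ^+ 3 * x i) ->
  (forall v, qform (fun i j => ip (H i) (H j) + ip p (t i j)) v <=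
     3 * r ^- 2 * ip v g ^+ 2 + 2 * e * r ^+ 3 * ip v v) ->
  ip x x <= n%:R /\ ip p p <= 2 * e * r ^+ 3 * n%:R.
Proof.
move=> r0 e0 rE Hsym gE pde dpde crit D2le.
set s := r ^+ 2 in rE pde dpde D2le *.
have s0 : 0 < s by rewrite exprn_gt0.
have er0 : 0 < 2 * e * r ^+ 3 by rewrite !mulr_gt0// exprn_gt0.
set c := 2 * e * r ^+ 3 in er0 crit D2le *.
pose D2 i j := ip (H i) (H j) + ip p (t i j).
pose A i j := 3 * s^-1 * (g i * g j) + c * (i == j)%:R + (-1) * D2 i j.
have AE v : qform A v = 3 * s^-1 * ip v g ^+ 2 + c * ip v v - qform D2 v.
  by rewrite 2!qformD 3!qformZ qform_prod qform_diag expr2 mulN1r.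
have psd v : 0 <= qform A v by rewrite AE subr_ge0 D2le.
have D2p : qform D2 p = ip g g + \sum_k p k * qform (fun i j => t i j k) p.
  have gfun : g = (fun i => ip p (H i)) by exact/funext.
  by rewrite gfun; exact: qform_second_order.
have D2tr : \sum_i D2 i i = \sum_i ip (H i) (H i) + \sum_i \sum_k p k * t i i k.
  by rewrite big_split.
have trE : \sum_i A i i = 3 * s^-1 * ip g g + c * n%:R - \sum_i D2 i i.
  rewrite 2!big_split/= -!mulr_sumr mulN1r; congr (_ + _ * _ - _).
  by under eq_bigr do rewrite eqxx; rewrite sumr_const card_ord.
have xg : ip x g = c * ip x x.
  by rewrite /ip mulr_sumr; apply: eq_bigr => i _; rewrite crit; ring.
have key := graph_curvature_ge0 Hsym rE gE.
have tr0 := qform_trace_ge0 psd.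
have trle := qform_le_trace p psd.
have {trle tr0} : qform A p <= s * \sum_i A i i.
  by rewrite (le_trans trle)// ler_wpM2r// rE lerDr.
rewrite AE trE D2p D2tr.
have LX : \sum_i H i i - ip x p = s^-1 * ip p g.
  by rewrite -pde mulrA mulVf ?mul1r// gt_eqF.
rewrite LX xg in dpde.
have := ip_ge0 x; have := ip_ge0 p.
move: key dpde rE.
move: (\sum_k p k * qform _ p) (\sum_i \sum_k p k * t i i k) => C T.
move: (\sum_i ip (H i) (H i)) => h.
move: (ip g g) (ip p g) (ip x x) (ip p p) => gg k xx pp.
have -> : s * (3 * s^-1 * gg + c * n%:R - (h + T)) = 3 * gg + s * (c * n%:R - h - T).
  by field; rewrite gt_eqF.
move=> key dpde sE pp0 xx0 ineq.
have main : c * pp + s * pp + s * (c * xx) <= s * (c * n%:R) by lra.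
have main2 : s * (c * xx) <= s * (c * n%:R).
  have : 0 <= s * pp by rewrite mulr_ge0// ltW.
  have : 0 <= c * pp by rewrite mulr_ge0// ltW.
  lra.
have main3 : s * pp <= s * (c * n%:R).
  have : 0 <= s * (c * xx) by rewrite !mulr_ge0// ltW.
  have : 0 <= c * pp by rewrite mulr_ge0// ltW.
  lra.
by move: main2 main3; rewrite !ler_pM2l.
Qed.

End Algebra.

(** * Partial derivatives of smooth functions *)

Section Smooth.
Context {R : realType} {V : normedModType R}.
Implicit Types (F : V -> R) (v w : V).

Lemma smooth_differentiable F x : smooth_on setT F -> differentiable F x.
Proof. by move=> /(_ [::] x I). Qed.

Lemma smooth_derive F v : smooth_on setT F -> smooth_on setT ('D_v F).
Proof. by move=> sF s x _; have := sF (rcons s v) x I; rewrite foldr_rcons. Qed.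

Lemma smooth_is_derive F x v : smooth_on setT F -> is_derive x v F ('D_v F x).
Proof. by move=> sF; exact/derivableP/diff_derivable/smooth_differentiable. Qed.

Lemma smooth_derive_comm F v w x : smooth_on setT F ->
  'D_w ('D_v F) x = 'D_v ('D_w F) x.
Proof.
move=> sF; have sD := smooth_derive _ sF.
have der (G : V -> R) (z y : V) : smooth_on setT G -> derivable G y z.
  by move=> sG; exact/diff_derivable/smooth_differentiable.
apply: derive_comm => [y|y|y|y||]; try exact/der/sD; try exact: der.
- exact/differentiable_continuous/smooth_differentiable/smooth_derive/sD.
- exact/differentiable_continuous/smooth_differentiable/smooth_derive/sD.
Qed.

Lemma is_derive_affine F x v (a : R) : (forall r : R, F (x + r *: v) = F x + r * a) ->
  is_derive x v F a.
Proof.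
move=> aff; have -> : x = x + (0 : R) *: v by rewrite scale0r addr0.
apply: line_is_derive.
rewrite (_ : (fun _ => _) = (fun r : R => F x + a * r)); last first.
  by apply/funext => r; rewrite aff mulrC.
apply: is_derive_eq (is_derive_add (is_derive_cst (F x) (0 : R) 1)
  (is_derive_scale a (is_derive_id (0 : R) 1))) _.
by rewrite add0r mulr1.
Qed.

End Smooth.

Section Coordinates.
Context {R : realType} {n : nat}.
Notation V := 'rV[R]_n.
Notation e := (@delta_mx R 1 n 0).
Implicit Types (F : V -> R) (x v w : V).

Lemma is_derive_coord x v i : is_derive x v (fun y : V => y 0 i) (v 0 i).
Proof. by apply: is_derive_affine => r; rewrite !mxE. Qed.

Lemma derive_coord F x v : differentiable F x ->
  'D_v F x = \sum_i v 0 i * 'D_(e i) F x.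
Proof.
move=> dF; rewrite deriveE// {1}(row_sum_delta v) linear_sum/=.
by apply: eq_bigr => i _; rewrite linearZ/= deriveE.
Qed.

End Coordinates.

Section PartialDerivatives.
Context {R : realType} {n : nat}.
Notation V := 'rV[R]_n.
Notation e := (@delta_mx R 1 n 0).
Implicit Types (F : V -> R) (x v w : V).

Definition pd F x : 'I_n -> R := fun i => 'D_(e i) F x.
Definition hess F x : 'I_n -> 'I_n -> R := fun i j => 'D_(e i) ('D_(e j) F) x.
Definition third F x : 'I_n -> 'I_n -> 'I_n -> R :=
  fun i j k => 'D_(e i) ('D_(e j) ('D_(e k) F)) x.

Lemma hess_sym F x i j : smooth_on setT F -> hess F x i j = hess F x j i.
Proof. by move=> sF; rewrite /hess smooth_derive_comm. Qed.

Lemma is_derive_pd F x v i : smooth_on setT F ->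
  is_derive x v (fun y => pd F y i) (ip (v 0) (hess F x i)).
Proof.
move=> sF; have sD := smooth_derive _ sF.
apply: is_derive_eq; first exact/smooth_is_derive/sD.
rewrite derive_coord; last exact/smooth_differentiable/sD.
by apply: eq_bigr => k _; rewrite /hess smooth_derive_comm.
Qed.

Lemma derive_hess F x i j k : smooth_on setT F ->
  'D_(e k) (fun y => hess F y i j) x = third F x i j k.
Proof.
move=> sF; have sD := smooth_derive _ sF.
apply: etrans (smooth_derive_comm _ _ _ (sD (e j))) _; rewrite /third.
have comm y := smooth_derive_comm (e j) (e k) y sF.
exact: (congr1 (fun G : V -> R => 'D_(e i) G x) (funext comm)).
Qed.

Lemma third_rot F x i j k : smooth_on setT F ->
  third F x k i j = third F x i j k.
Proof. by move=> sF; rewrite [LHS]/third; exact: derive_hess. Qed.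

Lemma is_derive_hess F x v i j : smooth_on setT F ->
  is_derive x v (fun y => hess F y i j) (ip (v 0) (third F x i j)).
Proof.
move=> sF; have sD := smooth_derive _ sF.
have sDD a b : smooth_on setT ('D_a ('D_b F)) by apply/smooth_derive/sD.
apply: is_derive_eq; first exact/smooth_is_derive/sDD.
rewrite derive_coord; last exact/smooth_differentiable/sDD.
by apply: eq_bigr => k _; rewrite derive_hess.
Qed.

Lemma is_derive_ip (W : normedModType R) (f g : W -> 'I_n -> R) (df dg : 'I_n -> R)
    (x v : W) :
  (forall i, is_derive x v (fun y => f y i) (df i)) ->
  (forall i, is_derive x v (fun y => g y i) (dg i)) ->
  is_derive x v (fun y => ip (f y) (g y)) (ip df (g x) + ip (f x) dg).
Proof.
move=> Df Dg; rewrite /ip -big_split/=.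
by apply: is_derive_sumf => i; exact: is_derive_mul.
Qed.

Lemma is_derive_qform (W : normedModType R) (A : W -> 'I_n -> 'I_n -> R)
    (f : W -> 'I_n -> R) dA df (x v : W) :
  (forall i j, is_derive x v (fun y => A y i j) (dA i j)) ->
  (forall i, is_derive x v (fun y => f y i) (df i)) ->
  is_derive x v (fun y => qform (A y) (f y))
    (qform dA (f x) + \sum_i \sum_j (df i * f x j + f x i * df j) * A x i j).
Proof.
move=> DA Df; rewrite /qform -big_split/=; apply: is_derive_sumf => i.
rewrite -big_split/=; apply: is_derive_sumf => j.
rewrite addrC; apply: is_derive_mul => //; exact: is_derive_mul.
Qed.

End PartialDerivatives.

(** * The minimal graph equation and its derivative *)

Section MinimalGraph.
Context {R : realType} {n : nat} (u : 'rV[R]_n -> R).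
Notation V := 'rV[R]_n.

(** The divergence form equation, expanded and multiplied by a power of
sqrt (1 + |grad u|^2): no square root is left to differentiate. *)
Definition minimal_graph_equation := forall y : V,
  (1 + ip (pd u y) (pd u y)) * (\sum_i hess u y i i - ip (y 0) (pd u y)) =
  qform (hess u y) (pd u y).

(** Differentiates the equation along the fixed vector p = grad u (x).  Symmetry of the
Hessian turns the derivative of grad u along p into g, half the gradient of
|grad u|^2. *)
Lemma derived_minimal_graph_equation (x : V) (p g : 'I_n -> R) :
  smooth_on setT u -> minimal_graph_equation ->
  p = pd u x -> (forall i, g i = ip p (hess u x i)) ->
  2 * ip p g * (\sum_i hess u x i i - ip (x 0) p)
    + (1 + ip p p) * (\sum_i \sum_k p k * third u x i i k - ip p p - ip (x 0) g)
    = 2 * ip g g + \sum_k p k * qform (fun i j => third u x i j k) p.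
Proof.
move=> su eqn pE gE.
pose v : V := \row_i p i.
have vE : v 0 = p by apply/funext => i; rewrite mxE.
have Dp i : is_derive x v (fun y => pd u y i) (g i).
  by rewrite gE -vE; exact: is_derive_pd.
have Dh i j : is_derive x v (fun y => hess u y i j) (ip p (third u x i j)).
  by rewrite -vE; exact: is_derive_hess.
have Dx i : is_derive x v (fun y : V => y 0 i) (p i).
  by rewrite -vE; exact: is_derive_coord.
have Dl := is_derive_mul
  (is_derive_add (is_derive_cst (1 : R) x v) (is_derive_ip Dp Dp))
  (is_derive_add (is_derive_sumf (fun i => Dh i i))
    (is_derive_scale (-1) (is_derive_ip (f := fun y : V => y 0) Dx Dp))).
have := is_derive_qform Dh Dp.
have -> : (fun y => qform (hess u y) (pd u y)) =
   (fun y => (cst 1 y + ip (pd u y) (pd u y)) *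
      (\sum_i hess u y i i + (-1) * ip (y 0) (pd u y))).
  by apply/funext => y; rewrite -eqn mulN1r.
case: Dl => _ Dl [_ Dr]; have := etrans (esym Dl) Dr.
have hsym i j := hess_sym x i j su.
move: hsym gE; rewrite -pE /cst {Dp Dh Dx Dl Dr pE eqn}.
move: (hess u x) (third u x) (x 0) => H t y Hsym gE.
rewrite add0r !mulN1r.
have -> : ip g p = ip p g by apply: eq_bigr => i _; rewrite mulrC.
have -> : \sum_i \sum_j (g i * p j + p i * g j) * H i j = 2 * ip g g.
  have gg1 : ip g g = \sum_i \sum_j g i * p j * H i j.
    apply: eq_bigr => i _; rewrite [X in _ * X]gE /ip mulr_sumr.
    by apply: eq_bigr => j _; rewrite mulrA.
  have gg2 : ip g g = \sum_i \sum_j p i * g j * H i j.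
    rewrite gg1 exchange_big; apply: eq_bigr => i _; apply: eq_bigr => j _.
    by rewrite Hsym [g j * _]mulrC.
  rewrite mulr_natl mulr2n {1}gg1 gg2 -big_split/=.
  apply: eq_bigr => i _; rewrite -big_split/=.
  by apply: eq_bigr => j _; rewrite mulrDl.
have -> : qform (fun i j => ip p (t i j)) p =
    \sum_k p k * qform (fun i j => t i j k) p.
  by rewrite qform_sum; apply: eq_bigr => k _; rewrite qformZ.
rewrite -[\sum_i \sum_k p k * t i i k]/(\sum_i ip p (t i i)) => raw.
rewrite [RHS]addrC -raw; ring.
Qed.

End MinimalGraph.

(** * The barrier *)

Lemma is_derive_inv_sqrt (R : realType) (t : R) : 0 < t ->
  is_derive t 1 (fun s => (Num.sqrt s)^-1) (- (2^-1 * (Num.sqrt t)^-1 ^+ 3)).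
Proof.
move=> t0; have sq0 : Num.sqrt t != 0 by rewrite gt_eqF// sqrtr_gt0.
apply: is_derive_eq (realfun.is_deriveV sq0 (is_derive1_sqrt t0)) _.
by rewrite /GRing.scale /=; field.
Qed.

Section Continuity.
Context {R : realType} {n : nat}.
Notation V := 'rV[R]_n.

Lemma ip_continuous (f g : V -> 'I_n -> R) :
  (forall i, continuous (fun y => f y i)) -> (forall i, continuous (fun y => g y i)) ->
  continuous (fun y => ip (f y) (g y)).
Proof.
move=> cf cg y; rewrite /ip.
rewrite (_ : (fun y => _) = \sum_i (fun y : V => f y i * g y i)); last first.
  by apply/funext => z; rewrite fct_sumE.
elim/big_ind : _ => [|F G cF cG|i _].
- exact: (@cst_continuous V R 0 y).
- exact: (continuousD cF cG).
- exact: (continuousM (cf i y) (cg i y)).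
Qed.

Lemma continuous_addf (F G : V -> R) :
  continuous F -> continuous G -> continuous (fun y => F y + G y).
Proof. by move=> cF cG y; exact: (continuousD (cF y) (cG y)). Qed.

Lemma continuous_mulf (F G : V -> R) :
  continuous F -> continuous G -> continuous (fun y => F y * G y).
Proof. by move=> cF cG y; exact: (continuousM (cF y) (cG y)). Qed.

Lemma continuous_cstf (a : R) : continuous (fun _ : V => a).
Proof. by move=> y; exact: (@cst_continuous V R a y). Qed.

Lemma box_attains_minimum (F : V -> R) (M : R) : 0 <= M -> continuous F ->
  exists z, forall y : V, (forall i, `|y 0 i| <= M) -> F z <= F y.
Proof.
move=> M0 cF; pose A := [set y : V | forall i, `[- M, M]%classic (y ord0 i)].
have A0 : A 0 by move=> i; rewrite /= mxE in_itv/= oppr_le0 M0.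
have cA : compact A.
  apply: (@rV_compact R n (fun _ => `[- M, M]%classic)) => i.
  exact: segment_compact.
have [||z _ zmin] := @EVT_min_rV R n F A _ cA; first by exists 0.
  exact/continuous_subspaceT.
by exists z => y yM; apply: zmin; rewrite inE => i /=; rewrite in_itv/= -ler_norml.
Qed.

End Continuity.

Section Barrier.
Context {R : realType} {n : nat} (u : 'rV[R]_n -> R).
Notation V := 'rV[R]_n.
Hypothesis su : smooth_on setT u.

(** The vertical coordinate of the upward unit normal of the graph. *)
Definition vnormal (y : V) : R := (Num.sqrt (1 + ip (pd u y) (pd u y)))^-1.
Definition barrier (c : R) (y : V) : R := vnormal y + c * ip (y 0) (y 0).

Let s_gt0 (y : V) : 0 < 1 + ip (pd u y) (pd u y).
Proof. by rewrite ltr_wpDr// ip_ge0. Qed.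

Lemma vnormal_gt0 y : 0 < vnormal y.
Proof. by rewrite invr_gt0 sqrtr_gt0. Qed.

Lemma vnormalV2 y : vnormal y ^- 2 = 1 + ip (pd u y) (pd u y).
Proof. by rewrite exprVn invrK sqr_sqrtr// ltW. Qed.

Lemma vnormal_le1 y : vnormal y <= 1.
Proof.
by rewrite invf_le1 ?sqrtr_gt0// -[leLHS]sqrtr1 ler_wsqrtr// lerDl ip_ge0.
Qed.

Lemma is_derive_vnormal y v :
  is_derive y v vnormal (- vnormal y ^+ 3 * ip (pd u y) (fun i => ip (v 0) (hess u y i))).
Proof.
pose w i := ip (v 0) (hess u y i).
have Dp i : is_derive y v (fun z => pd u z i) (w i) by exact: is_derive_pd.
have Ds := is_derive_add (is_derive_cst (1 : R) y v) (is_derive_ip Dp Dp).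
apply: is_derive_eq (is_derive_comp1
  (F := fun z => 1 + ip (pd u z) (pd u z)) (is_derive_inv_sqrt (s_gt0 y)) Ds) _.
rewrite -/(vnormal y) add0r.
have -> : ip w (pd u y) = ip (pd u y) w by apply: eq_bigr => i _; rewrite mulrC.
by field.
Qed.

Lemma is_derive_barrier c y v :
  is_derive y v (barrier c)
    (- vnormal y ^+ 3 * ip (pd u y) (fun i => ip (v 0) (hess u y i))
     + 2 * c * ip (y 0) (v 0)).
Proof.
have Dx i : is_derive y v (fun z : V => z 0 i) (v 0 i) by exact: is_derive_coord.
apply: is_derive_eq (is_derive_add (is_derive_vnormal y v)
  (is_derive_scale c (is_derive_ip (f := fun z : V => z 0) Dx Dx))) _.
have -> : ip (v 0) (y 0) = ip (y 0) (v 0) by apply: eq_bigr => i _; rewrite mulrC.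
ring.
Qed.

Lemma is_derive2_barrier c (y v : V) (w : 'I_n -> R) :
  w = (fun i => ip (v 0) (hess u y i)) ->
  is_derive y v ('D_v (barrier c))
    (3 * vnormal y ^+ 5 * ip (pd u y) w ^+ 2
     - vnormal y ^+ 3 * (ip w w + ip (pd u y) (fun k => qform (fun i j => third u y i j k) (v 0)))
     + 2 * c * ip (v 0) (v 0)).
Proof.
move=> wE.
have -> : (fun z => 'D_v (barrier c) z) =
  (fun z : V => (-1) * (vnormal z * (vnormal z * vnormal z)) *
      ip (pd u z) (fun i => ip (v 0) (hess u z i)) + 2 * c * ip (z 0) (v 0)).
  apply/funext => z; have [_ ->] := is_derive_barrier c z v.
  by congr (_ * _ + _); ring.
have Dp i : is_derive y v (fun z => pd u z i) (w i).
  by rewrite wE; exact: is_derive_pd.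
have Dv i : is_derive y v (fun _ : V => v 0 i) 0 by exact: is_derive_cst.
have Dw i : is_derive y v (fun z => ip (v 0) (hess u z i))
    (qform (fun j k => third u y j k i) (v 0)).
  have Dh k : is_derive y v (fun z => hess u z i k) (ip (v 0) (third u y i k)).
    exact: is_derive_hess.
  apply: is_derive_eq (is_derive_ip (f := fun _ => v 0) Dv Dh) _.
  rewrite {1}/ip big1 ?add0r => [|j _]; last by rewrite mul0r.
  rewrite /ip /qform; apply: eq_bigr => k _; rewrite mulr_sumr; apply: eq_bigr => j _.
  by rewrite third_rot// mulrA.
have Dx i : is_derive y v (fun z : V => z 0 i) (v 0 i) by exact: is_derive_coord.
have Dn := is_derive_vnormal y v.
apply: is_derive_eq (is_derive_add (is_derive_mul (is_derive_scale (-1)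
    (is_derive_mul Dn (is_derive_mul Dn Dn))) (is_derive_ip Dp Dw))
  (is_derive_scale (2 * c) (is_derive_ip (f := fun z : V => z 0) Dx Dv))) _.
have -> : ip (y 0) (fun _ => 0) = 0 by rewrite /ip big1// => i _; rewrite mulr0.
rewrite -wE addr0.
move: (ip (pd u y) w) (ip w w) (ip _ _) (ip (v 0) (v 0)) => a b d f; ring.
Qed.

Lemma gram_continuous : continuous (fun y : V => 1 + ip (pd u y) (pd u y)).
Proof.
have cp i : continuous (fun y => pd u y i).
  by move=> y; exact/differentiable_continuous/smooth_differentiable/smooth_derive.
apply: (continuous_addf (F := fun=> 1)); first exact: continuous_cstf.
exact: ip_continuous.
Qed.

Lemma vnormal_continuous : continuous vnormal.
Proof.
move=> y.
have sq0 : Num.sqrt (1 + ip (pd u y) (pd u y)) != 0 by rewrite gt_eqF// sqrtr_gt0.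
apply: (continuousV (s := fun y : V => Num.sqrt (1 + ip (pd u y) (pd u y))) sq0).
apply: (@continuous_comp _ _ _ (fun y : V => 1 + ip (pd u y) (pd u y)) Num.sqrt).
  exact: gram_continuous.
exact: sqrt_continuous.
Qed.

Lemma barrier_continuous c : continuous (barrier c).
Proof.
have cc i : continuous (fun y : V => y 0 i) by exact: coord_continuous.
apply: continuous_addf; first exact: vnormal_continuous.
apply: (continuous_mulf (F := fun=> c)); first exact: continuous_cstf.
exact: (ip_continuous (f := fun y : V => y 0)).
Qed.

(** Outside the box of half-width 1/c + 1 the quadratic term exceeds 1, hence the
value at 0. *)
Lemma barrier_attains_minimum c : 0 < c ->
  exists x, forall y : V, barrier c x <= barrier c y.
Proof.
move=> c0; pose M := c^-1 + 1.
have M1 : 1 <= M by rewrite lerDr invr_ge0 ltW.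
have M0 : 0 <= M by rewrite (le_trans ler01).
have [x xmin] := box_attains_minimum M0 (@barrier_continuous c).
exists x => y; have [yM|] := pselect (forall i, `|y 0 i| <= M); first exact: xmin.
move=> /existsNP[i /negP]; rewrite -ltNge => yi.
have : barrier c x <= barrier c 0 by apply: xmin => k; rewrite mxE normr0.
move=> /le_trans; apply.
have -> : barrier c 0 = vnormal 0.
  by rewrite /barrier /ip big1 ?mulr0 ?addr0// => k _; rewrite mxE mul0r.
rewrite (le_trans (vnormal_le1 _))// /barrier ler_wpDl ?(ltW (vnormal_gt0 y))//.
rewrite -ler_pdivrMl// mulr1 (@le_trans _ _ (y 0 i * y 0 i))//.
  have -> : y 0 i * y 0 i = `|y 0 i| * `|y 0 i| by rewrite -!expr2 real_normK ?num_real.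
  rewrite (@le_trans _ _ (M * M))//.
    by rewrite (@le_trans _ _ M)// ?lerDl// ler_peMl.
  by rewrite ler_pM// ltW.
by rewrite /ip (bigD1 i)//= lerDl sumr_ge0// => j _; rewrite -expr2 sqr_ge0.
Qed.

(** The conditions of order one and two at the minimum, multiplied by the cube of the
inverse of [vnormal], are the hypotheses of [interior_minimum_bound]. *)
Lemma barrier_minimum_bound c x : minimal_graph_equation u -> 0 < c ->
  (forall y, barrier c x <= barrier c y) ->
  ip (x 0) (x 0) <= n%:R /\
  ip (pd u x) (pd u x) <= 2 * c * vnormal x ^- 3 * n%:R.
Proof.
move=> eqn c0 xmin.
pose g i := ip (pd u x) (hess u x i).
have hs i j := hess_sym x i j su.
have db v y : derivable (barrier c) y v by case: (is_derive_barrier c y v).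
have nu0 := vnormal_gt0 x.
pose r := (vnormal x)^-1; have r0 : 0 < r by rewrite invr_gt0.
have rE : r ^+ 2 = 1 + ip (pd u x) (pd u x) by rewrite exprVn vnormalV2.
have -> : vnormal x ^- 3 = r ^+ 3 by rewrite /r exprVn.
have crit v : g v = 2 * c * r ^+ 3 * x 0 v.
  pose ev : V := delta_mx 0 v.
  have evE f : ip (ev 0) f = f v.
    by rewrite /ip /ev; under eq_bigr do rewrite mxE eqxx /=; exact: sum_delta.
  have [_ D0] := is_derive_barrier c x ev.
  move: D0; rewrite (derive_min xmin (db _)).
  rewrite (_ : (fun i => _) = (fun i => hess u x v i)); last first.
    by apply/funext => i; rewrite evE hs.
  have -> : ip (x 0) (ev 0) = x 0 v.
    by rewrite -[RHS](evE (x 0)); apply: eq_bigr => i _; rewrite mulrC.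
  rewrite -/(g v) => /esym/eqP; rewrite mulNr addrC subr_eq0 => /eqP E.
  rewrite mulrAC E /r; field; exact: lt0r_neq0.
apply: (@interior_minimum_bound _ _ (x 0) (pd u x) g (hess u x) (third u x) r c) => //.
- by rewrite rE; have := eqn x; rewrite /qform => ->; rewrite /ip; apply: eq_bigr => i _;
    rewrite /g /ip mulr_sumr; apply: eq_bigr => j _; rewrite mulrA.
- by rewrite rE; exact: derived_minimal_graph_equation.
move=> v; pose V0 : V := \row_i v i.
have vE : V0 0 = v by apply/funext => i; rewrite mxE.
pose w i := ip v (hess u x i).
have [|d2 D2] := @is_derive2_barrier c x V0 w; first by rewrite vE.
have := derive2_min xmin (db V0) d2; rewrite D2 vE.
have -> : ip (pd u x) w = ip v g by rewrite -ip_selfadjoint.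
rewrite qform_second_order// -/w.
move: (ip w w + _) (ip v g) (ip v v) => T a b ineq.
have nuE : vnormal x = r^-1 by rewrite invrK.
rewrite -subr_ge0 -(pmulr_rge0 _ (exprn_gt0 3 nu0)).
rewrite (_ : vnormal x ^+ 3 * _ = 3 * vnormal x ^+ 5 * a ^+ 2 - vnormal x ^+ 3 * T + 2 * c * b)//.
by rewrite nuE; field; rewrite gt_eqF.
Qed.

End Barrier.

(** * Entire solutions are constant *)

Section Liouville.
Context {R : realType} {n : nat} (u : 'rV[R]_n -> R).
Notation V := 'rV[R]_n.
Hypothesis su : smooth_on setT u.
Hypothesis eqn : minimal_graph_equation u.

(** All minimum points of the barriers lie in one ball, whence a lower bound that does
not depend on the coefficient c. *)
Lemma vnormal_bounded_below : exists2 m : R, 0 < m &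
  forall x : V, ip (x 0) (x 0) <= n%:R -> m <= vnormal u x.
Proof.
(* |x i| > n + 1 would give |x|^2 > (n + 1)^2 > n. *)
pose M : R := n%:R + 1.
have M0 : 0 <= M by rewrite addr_ge0.
have [z zmin] := box_attains_minimum M0 (vnormal_continuous su).
exists (vnormal u z); first exact: vnormal_gt0.
move=> x xn; apply: zmin => i; rewrite leNgt; apply/negP => Mx.
have : (x 0 i) ^+ 2 <= n%:R.
  apply: le_trans xn; rewrite /ip (bigD1 i)//= -expr2 lerDl sumr_ge0// => j _.
  by rewrite -expr2 sqr_ge0.
rewrite -[(x 0 i) ^+ 2]real_normK ?num_real// leNgt => /negP; apply.
have n0 : 0 <= n%:R :> R by [].
move: Mx; rewrite /M; move: (n%:R) (`|x 0 i|) n0 => a b a0 ab; nra.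
Qed.

Lemma vnormal_eq1 y : vnormal u y = 1.
Proof.
have [m m0 mle] := vnormal_bounded_below.
apply/eqP; rewrite eq_le vnormal_le1/= leNgt; apply/negP => y1.
(* The final inequality reads 1 <= nu y + c (K - 1); this c makes c K half of the
   gap 1 - nu y, and the summand 1 makes K positive. *)
pose K := 2 * m ^- 3 * n%:R + ip (y 0) (y 0) + 1.
have K0 : 0 < K.
  by rewrite ltr_wpDl// addr_ge0 ?ip_ge0// !mulr_ge0// invr_ge0 exprn_ge0// ltW.
pose c := (1 - vnormal u y) / 2 / K.
have c0 : 0 < c by rewrite !divr_gt0// subr_gt0.
have [x xmin] := barrier_attains_minimum su c0.
have [xn px] := barrier_minimum_bound su eqn c0 xmin.
have mx := mle _ xn.
have sx0 := vnormal_gt0 u x; have sx1 := vnormal_le1 u x.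
have px' : ip (pd u x) (pd u x) <= c * (2 * m ^- 3 * n%:R).
  rewrite (le_trans px)// (_ : c * _ = 2 * c * m ^- 3 * n%:R); last by ring.
  have c2 : 0 <= 2 * c by rewrite mulr_ge0// ltW.
  rewrite ler_wpM2r// ler_wpM2l// lef_pV2 ?posrE ?exprn_gt0//.
  by rewrite ler_pXn2r// nnegrE ltW.
have sq : 1 <= vnormal u x * (1 + ip (pd u x) (pd u x)).
  rewrite -vnormalV2; have -> : vnormal u x * vnormal u x ^- 2 = (vnormal u x)^-1.
    by field; rewrite gt_eqF.
  by rewrite invf_ge1.
have pp0 := ip_ge0 (pd u x).
have key : 1 - ip (pd u x) (pd u x) <= vnormal u x by nra.
have := xmin y; rewrite /barrier => xy.
have xx0 : 0 <= c * ip (x 0) (x 0) by rewrite mulr_ge0 ?ip_ge0// ltW.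
have cK : c * K = (1 - vnormal u y) / 2 by rewrite /c divfK// gt_eqF.
have cK2 : c * K = c * (2 * m ^- 3 * n%:R) + c * ip (y 0) (y 0) + c.
  by rewrite /K; ring.
lra.
Qed.

Lemma minimal_graph_constant : exists a, forall y, u y = a.
Proof.
have pd0 y i : pd u y i = 0.
  have : ip (pd u y) (pd u y) = 0.
    by have := vnormalV2 u y; rewrite vnormal_eq1 expr1n invr1; lra.
  move=> /eqP; rewrite psumr_eq0 => [/allP/(_ i)|j _]; last by rewrite -expr2 sqr_ge0.
  by rewrite mem_index_enum => /(_ isT); rewrite -expr2 sqrf_eq0 => /eqP.
exists (u 0) => y; apply/eqP; rewrite -subr_eq0.
have [z|c _] := @mean_value_line R V u 0 y 1 ltr01.
  exact/diff_derivable/smooth_differentiable.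
rewrite add0r scale1r => ->; rewrite derive_coord; last exact: smooth_differentiable.
by rewrite big1 ?mulr0// => i _; rewrite [X in _ * X]pd0 mulr0.
Qed.

End Liouville.

(** * Shape operator of a graph *)

Section Curves.
Context {R : realType}.

Lemma is_derive_rV (W : normedModType R) m (M : W -> 'rV[R]_m) t v (d : 'rV[R]_m) :
  (forall j, is_derive t v (fun y => M y 0 j) (d 0 j)) -> is_derive t v M d.
Proof.
move=> Md; have dM : derivable M t v.
  by apply/derivable_mxP => i j; rewrite ord1; case: (Md j).
apply: DeriveDef => //; rewrite derive_mx//.
by apply/rowP => j; rewrite mxE; case: (Md j).
Qed.

Lemma rV_is_derive (W : normedModType R) m (M : W -> 'rV[R]_m) t v (d : 'rV[R]_m) j :
  is_derive t v M d -> is_derive t v (fun y => M y 0 j) (d 0 j).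
Proof.
move=> [dM <-]; rewrite derive_mx// mxE.
by apply/derivableP; move/derivable_mxP : dM; apply.
Qed.

Lemma is_derive_curve m k (N : 'rV[R]_m -> 'rV[R]_k) (c : R -> 'rV[R]_m) (w : 'rV[R]_m) :
  is_derive (0 : R) 1 c w -> differentiable N (c 0) ->
  is_derive (0 : R) 1 (N \o c) (w *m 'J N (c 0)).
Proof.
move=> [dc cw] dN; have dc' : differentiable c 0 by exact/derivable1_diffP.
have dNc : differentiable (N \o c) 0 by exact: differentiable_comp.
apply: DeriveDef; first exact/derivable1_diffP.
by rewrite deriveE// diff_comp//= -deriveE// deriveEjacobian// -deriveE// cw.
Qed.

End Curves.

Section GraphGeometry.
Context {R : realType} {n : nat} (u : 'rV[R]_n -> R).
Notation V := 'rV[R]_n.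
Hypothesis su : smooth_on setT u.

Definition lift_graph (y : V) : 'rV[R]_(n + 1) := row_mx y (const_mx (u y)).
Definition lift_tangent (y v : V) : 'rV[R]_(n + 1) := row_mx v (const_mx ('D_v u y)).

Lemma is_derive_lift_graph (x v : V) (t : R) :
  is_derive t 1 (fun r : R => lift_graph (x + r *: v)) (lift_tangent (x + t *: v) v).
Proof.
apply: is_derive_rV => j; rewrite /lift_graph /lift_tangent.
case: (split_ordP j) => i ->.
- rewrite row_mxEl (_ : (fun _ => _) = (fun r : R => (x + r *: v) 0 i)); last first.
    by apply/funext => r; rewrite row_mxEl.
  by apply: (is_derive_line (F := fun y : V => y 0 i)); exact: is_derive_coord.
- rewrite row_mxEr mxE (_ : (fun _ => _) = (fun r : R => u (x + r *: v))); last first.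
    by apply/funext => r; rewrite row_mxEr mxE.
  by apply: is_derive_line; exact: smooth_is_derive.
Qed.

Lemma lift_tangentP (x v : V) : tangent (graph u) (lift_graph x) (lift_tangent x v).
Proof.
exists (fun r : R => lift_graph (x + r *: v)); split.
- by rewrite scale0r addr0.
- by near=> r; exists (x + r *: v).
- by have := is_derive_lift_graph x v 0; rewrite scale0r addr0.
Unshelve. all: by end_near. Qed.

Lemma near_lift_graph (x v : V) (U : set 'rV[R]_(n + 1)) : open U -> U (lift_graph x) ->
  \forall t \near (0 : R), U (lift_graph (x + t *: v)).
Proof.
move=> oU Ux.
have [dc _] := is_derive_lift_graph x v 0.
have /differentiable_continuous : differentiable (fun r : R => lift_graph (x + r *: v)) 0.
  exact/derivable1_diffP.
apply; rewrite scale0r addr0; exact: open_nbhs_nbhs.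
Qed.

Lemma dot_lift (x v : V) (w : 'rV[R]_(n + 1)) :
  dot w (lift_tangent x v) =
  ip (fun i => w 0 (lshift 1 i)) (v 0) + w 0 (rshift n ord0) * 'D_v u x.
Proof.
rewrite /dot big_split_ord/= big_ord1 row_mxEr mxE; congr (_ + _).
by apply: eq_bigr => i _; rewrite row_mxEl.
Qed.

(** Differentiates <N, lift_tangent w> = 0 along the curve of the graph above the
line x + t v: the derivative of the tangent vector is vertical, with last coordinate
the second derivative of u. *)
Lemma shape_on_tangents (x v w : V) (U : set 'rV[R]_(n + 1))
    (N : 'rV[R]_(n + 1) -> 'rV[R]_(n + 1)) :
  open U -> U (lift_graph x) -> unit_normal_on (graph u) U N ->
  dot (lift_tangent x v *m 'J N (lift_graph x)) (lift_tangent x w) =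
  - N (lift_graph x) 0 (rshift n ord0) * 'D_v ('D_w u) x.
Proof.
move=> oU Ux [sN normal].
pose c (r : R) := lift_graph (x + r *: v).
have c0 : c 0 = lift_graph x by rewrite /c scale0r addr0.
have Dc : is_derive (0 : R) 1 c (lift_tangent x v).
  by have := is_derive_lift_graph x v 0; rewrite scale0r addr0.
have dN : differentiable N (c 0) by have := sN [::] (c 0); apply; rewrite c0.
have DN j := rV_is_derive j (is_derive_curve Dc dN).
have Du : is_derive (0 : R) 1 (fun r => 'D_w u (x + r *: v)) ('D_v ('D_w u) x).
  apply: (is_derive_line (F := 'D_w u)); rewrite scale0r addr0.
  exact/smooth_is_derive/smooth_derive.
have Dw i : is_derive (0 : R) 1 (fun _ : R => w 0 i) 0 by exact: is_derive_cst.
have := is_derive_add (is_derive_ip (f := fun r i => (N \o c) r 0 (lshift 1 i))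
   (fun i => DN (lshift 1 i)) Dw) (is_derive_mul (DN (rshift n ord0)) Du).
have : {near (0 : R), (fun=> 0) =1 (fun r =>
   ip (fun i => (N \o c) r 0 (lshift 1 i)) (w 0)
   + (N \o c) r 0 (rshift n ord0) * 'D_w u (x + r *: v))}.
  have := near_lift_graph v oU Ux.
  apply: filterS => r Ur; rewrite -dot_lift.
  have [|_ ->//] := normal (c r) _ Ur; last exact: lift_tangentP.
  by exists (x + r *: v).
move=> zero [_]; rewrite -(near_eq_derive _ zero) ?oner_eq0// derive_cst.
rewrite c0 scale0r addr0 dot_lift /= c0.
have -> : ip (fun i => N (lift_graph x) 0 (lshift 1 i)) (fun=> 0) = 0.
  by rewrite /ip big1// => i _; rewrite mulr0.
rewrite addr0 => E; apply/eqP; rewrite mulNr -subr_eq0 opprK -addrA.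
by apply/eqP; rewrite -E.
Qed.

End GraphGeometry.

(** * From weighted minimality to the equation *)

Section Potential.
Context {R : realType} {n : nat}.

Lemma gauss_line_potentialE (p : 'rV[R]_(n + 1)) :
  gauss_line_potential p =
  - ln ((2 * pi) `^ (- (n%:R / 2))) + 2^-1 * ip (lsubmx p 0) (lsubmx p 0).
Proof.
rewrite /gauss_line_potential /gauss_line_density /gauss_density.
rewrite lnM ?posrE ?expR_gt0 ?powR_gt0 ?mulr_gt0 ?pi_gt0//.
by rewrite expRK opprD opprK; congr (_ + _); rewrite mulrC.
Qed.

Lemma dot_grad_potential (p w : 'rV[R]_(n + 1)) :
  dot (grad (@gauss_line_potential R n) p) w = ip (lsubmx p 0) (lsubmx w 0).
Proof.
have D k : 'D_(delta_mx 0 k) (@gauss_line_potential R n) p =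
    \sum_(i < n) lsubmx p 0 i * (k == lshift 1 i)%:R.
  have Dx i : is_derive p (delta_mx 0 k) (fun q : 'rV[R]_(n + 1) => lsubmx q 0 i)
      ((delta_mx 0 k : 'rV[R]_(n + 1)) 0 (lshift 1 i)).
    rewrite (_ : (fun _ => _) = (fun q : 'rV[R]_(n + 1) => q 0 (lshift 1 i))).
      exact: is_derive_coord.
    by apply/funext => q; rewrite mxE.
  have := is_derive_add
    (is_derive_cst (- ln ((2 * pi) `^ (- (n%:R / 2))) : R) p (delta_mx 0 k))
    (is_derive_scale 2^-1 (is_derive_ip (f := fun q : 'rV[R]_(n + 1) => lsubmx q 0) Dx Dx)).
  rewrite (_ : (fun _ => _) = @gauss_line_potential R n); last first.
    by apply/funext => q; rewrite gauss_line_potentialE.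
  move=> [_ ->]; rewrite add0r.
  have -> : ip (fun i => (delta_mx 0 k : 'rV[R]_(n + 1)) 0 (lshift 1 i)) (lsubmx p 0) =
     ip (lsubmx p 0) (fun i => (delta_mx 0 k : 'rV[R]_(n + 1)) 0 (lshift 1 i)).
    by apply: eq_bigr => i _; rewrite mulrC.
  have half (a : R) : 2^-1 * (a + a) = a by field.
  rewrite half.
  by apply: eq_bigr => i _; rewrite [delta_mx _ _ _ _]mxE eqxx eq_sym.
rewrite /dot; under eq_bigr => k _ do rewrite mxE D mulr_suml.
rewrite exchange_big; apply: eq_bigr => i _.
rewrite [lsubmx w 0 i]mxE -(sum_delta (lshift 1 i) (w 0)) mulr_sumr.
by apply: eq_bigr => k _; rewrite mulrA.
Qed.

End Potential.

Section GraphEquation.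
Context {R : realType} {n : nat} (u : 'rV[R]_n -> R).
Notation V := 'rV[R]_n.
Notation e := (@delta_mx R 1 n 0).
Hypothesis su : smooth_on setT u.

Lemma delta_row (i : 'I_n) (f : 'I_n -> R) : ip f (e i 0) = f i.
Proof.
rewrite -[RHS](sum_delta i f); apply: eq_bigr => j _.
by rewrite mxE eqxx mulrC.
Qed.

(** The rows of T are the coordinate tangent vectors of a graph with gradient p, and
the middle factor is the inverse of their Gram matrix. *)
Lemma projection_tangent (p : 'I_n -> R) (T : 'M[R]_(n, n + 1)) (N : 'rV[R]_(n + 1)) (nu : R) :
  (forall i j, T i (lshift 1 j) = (i == j)%:R) -> (forall i, T i (rshift n ord0) = p i) ->
  (forall i, N 0 (lshift 1 i) = - nu * p i) -> N 0 (rshift n ord0) = nu ->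
  nu ^+ 2 * (1 + ip p p) = 1 ->
  proj_orth N = T^T *m (\matrix_(i, j) ((i == j)%:R - nu ^+ 2 * (p i * p j))) *m T.
Proof.
move=> Tl Tr Nl Nr nuE.
have pT k l : (T^T *m (\matrix_(i, j) ((i == j)%:R - nu ^+ 2 * (p i * p j))) *m T) k l
   = \sum_i T i k * T i l - nu ^+ 2 * (\sum_i p i * T i k) * (\sum_i p i * T i l).
  rewrite -mulmxA mxE; under eq_bigr => i _.
    rewrite !mxE (_ : \sum_j _ = T i l - nu ^+ 2 * p i * \sum_j p j * T j l); last first.
      rewrite mulr_sumr -[T i l](sum_delta i (fun j => T j l)) -sumrB.
      by apply: eq_bigr => j _; rewrite !mxE eq_sym; ring.
    rewrite mulrBr; over.
  rewrite sumrB -mulrA mulr_suml mulr_sumr; congr (_ - _).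
  by apply: eq_bigr => i _; ring.
have pl a : \sum_i p i * T i (lshift 1 a) = p a.
  by under eq_bigr do rewrite Tl mulrC; exact: sum_delta.
have pr : \sum_i p i * T i (rshift n ord0) = ip p p.
  by apply: eq_bigr => i _; rewrite Tr.
have TTll a b : \sum_i T i (lshift 1 a) * T i (lshift 1 b) = (a == b)%:R.
  by under eq_bigr do rewrite Tl; rewrite (sum_delta a (fun i => T i (lshift 1 b))) Tl.
have TTlr a : \sum_i T i (lshift 1 a) * T i (rshift n ord0) = p a.
  by under eq_bigr do rewrite Tl; rewrite (sum_delta a (fun i => T i (rshift n ord0))) Tr.
have TTrl a : \sum_i T i (rshift n ord0) * T i (lshift 1 a) = p a.
  by rewrite -TTlr; apply: eq_bigr => i _; rewrite mulrC.
have TTrr : \sum_i T i (rshift n ord0) * T i (rshift n ord0) = ip p p.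
  by apply: eq_bigr => i _; rewrite Tr.
have nuE2 : 1 - nu ^+ 2 * ip p p = nu ^+ 2 by rewrite -[1]nuE; ring.
apply/matrixP => k l; rewrite pT /proj_orth !mxE big_ord1 mxE.
case: (split_ordP k) => a ->; case: (split_ordP l) => b ->;
  rewrite ?(ord1 a) ?(ord1 b) ?pl ?pr ?TTll ?TTlr ?TTrl ?TTrr ?Nl ?Nr
    ?eq_lshift ?eq_rshift ?eq_lrshift ?eq_rlshift ?eqxx /=.
- ring.
- have -> : p a - nu ^+ 2 * p a * ip p p = p a * (1 - nu ^+ 2 * ip p p) by ring.
  by rewrite nuE2; ring.
- have -> : p b - nu ^+ 2 * ip p p * p b = p b * (1 - nu ^+ 2 * ip p p) by ring.
  by rewrite nuE2; ring.
- have -> : ip p p - nu ^+ 2 * ip p p * ip p p = ip p p * (1 - nu ^+ 2 * ip p p) by ring.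
  by rewrite nuE2 -[1]nuE; ring.
Qed.

Lemma trace_shape (p : 'I_n -> R) (h : 'I_n -> 'I_n -> R) (T : 'M[R]_(n, n + 1))
    (J : 'M[R]_(n + 1)) (nu : R) :
  (forall i j, h i j = h j i) ->
  (forall i j, (T *m J *m T^T) i j = - nu * h i j) ->
  \tr (T^T *m (\matrix_(i, j) ((i == j)%:R - nu ^+ 2 * (p i * p j))) *m T *m (- J)) =
  nu * (\sum_i h i i - nu ^+ 2 * qform h p).
Proof.
move=> hsym TJ; rewrite mulmxN raddfN/= -!mulmxA mxtrace_mulC -!mulmxA (mulmxA T) /mxtrace.
rewrite mulrBr mulr_sumr mulrA /qform mulr_sumr -sumrB -sumrN; apply: eq_bigr => i _.
rewrite mxE mulr_sumr; under eq_bigr => j _ do rewrite TJ !mxE.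
rewrite -[nu * h i i](sum_delta i (fun j => nu * h j i)) -sumrB -sumrN.
by apply: eq_bigr => j _; rewrite eq_sym (hsym i j); ring.
Qed.

Lemma weighted_minimal_graph_equation :
  weighted_minimal (@gauss_line_potential R n) (graph u) -> minimal_graph_equation u.
Proof.
move=> [_ wm] x.
have Gx : graph u (lift_graph u x) by exists x.
have [U [N [oU Ux uN Hf]]] := wm _ Gx.
have [NN Ntan] := uN.2 _ Gx Ux.
pose p := pd u x; pose nu : R := N (lift_graph u x) 0 (rshift n ord0).
pose T := \matrix_(i < n) lift_tangent u x (e i).
have Tl i j : T i (lshift 1 j) = (i == j)%:R.
  by rewrite mxE row_mxEl mxE eqxx eq_sym.
have Tr i : T i (rshift n ord0) = p i by rewrite mxE row_mxEr mxE.
have Nl i : N (lift_graph u x) 0 (lshift 1 i) = - nu * p i.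
  have := Ntan _ (lift_tangentP su x (e i)); rewrite dot_lift delta_row => /eqP.
  by rewrite addr_eq0 mulNr => /eqP.
have nuE : nu ^+ 2 * (1 + ip p p) = 1.
  rewrite -[RHS]NN /dot big_split_ord/= big_ord1 mulrDr mulr1 addrC expr2.
  congr (_ + _); rewrite /ip mulr_sumr; apply: eq_bigr => i _.
  by rewrite Nl; ring.
have nu0 : nu != 0.
  by apply: contra_eq_neq nuE => ->; rewrite expr0n mul0r eq_sym oner_eq0.
have TJ i j : (T *m 'J N (lift_graph u x) *m T^T) i j = - nu * hess u x i j.
  rewrite -(shape_on_tangents su (e i) (e j) oU Ux uN) mxE.
  apply: eq_bigr => k _; congr (_ * _); last by rewrite !mxE.
  by rewrite -(rowK (fun l => lift_tangent u x (e l)) i) -row_mul [RHS]mxE.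
move: Hf; rewrite /weighted_mean_curvature /mean_curvature /shape_operator.
rewrite (projection_tangent Tl Tr Nl erefl nuE).
rewrite (trace_shape _ (fun i j => hess_sym x i j su) TJ) dot_grad_potential.
rewrite row_mxKl.
have -> : ip (x 0) (lsubmx (N (lift_graph u x)) 0) = - nu * ip (x 0) p.
  by rewrite /ip mulr_sumr; apply: eq_bigr => i _; rewrite mxE Nl; ring.
rewrite mulNr -mulrBr => /eqP; rewrite mulf_eq0 (negbTE nu0)/= => /eqP E.
rewrite -/p; have -> : \sum_i hess u x i i - ip (x 0) p = nu ^+ 2 * qform (hess u x) p.
  by apply/eqP; rewrite -subr_eq0 -[X in _ == X]E; apply/eqP; ring.
by rewrite mulrA [_ * nu ^+ 2]mulrC nuE mul1r.
Qed.

End GraphEquation.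

(** * Hyperplanes *)

Section Hyperplane.
Context {R : realType} {n : nat}.
Notation last := (rshift n (@ord0 0)).

Lemma smooth_cst (V W : normedModType R) (U : set V) (w : W) : smooth_on U (cst w).
Proof.
move=> s p _; suff [w' ->] : exists w', foldr (fun v G => 'D_v G) (cst w) s = cst w'.
  exact: differentiable_cst.
elim: s => [|v s [w' IH]]; first by exists w.
by exists 0; rewrite /= IH; apply/funext => q; rewrite derive_cst.
Qed.

Lemma is_derive_height (a : R) (q v : 'rV[R]_(n + 1)) :
  is_derive q v (fun q : 'rV[R]_(n + 1) => q 0 last + - a) (v 0 last).
Proof.
apply: is_derive_eq (is_derive_add (is_derive_coord q v last) (is_derive_cst (- a) q v)) _.
by rewrite addr0.
Qed.

(** After one differentiation the function is constant. *)
Lemma smooth_height (a : R) :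
  smooth_on setT (fun q : 'rV[R]_(n + 1) => q 0 last + - a).
Proof.
move=> s p _; elim/last_ind: s => [|s v _] /=.
  apply: (@differentiableD _ _ _ (fun q : 'rV[R]_(n + 1) => q 0 last) (cst (- a))).
    exact: differentiable_coord.
  exact: differentiable_cst.
rewrite foldr_rcons (_ : (fun q => 'D_v _ q) = cst (v 0 last)).
  exact: smooth_cst.
by apply/funext => q; have [_ ->] := is_derive_height a q v.
Qed.

Lemma horizontal_hyperplaneE (a : R) (p : 'rV[R]_(n + 1)) :
  horizontal_hyperplane a p <-> p 0 last = a.
Proof. by rewrite /horizontal_hyperplane /= mxE. Qed.

Lemma hypersurface_horizontal_hyperplane (a : R) :
  hypersurface (@horizontal_hyperplane R n a).
Proof.
move=> p _; exists setT, (fun q : 'rV[R]_(n + 1) => q 0 last + - a); split => //.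
- exact: openT.
- exact: smooth_height.
- move=> q _; apply/eqP => /rowP/(_ last); rewrite !mxE.
  have [_ ->] := is_derive_height a q (delta_mx 0 last).
  by rewrite mxE !eqxx => /eqP; rewrite oner_eq0.
- rewrite setIT; apply/seteqP; split=> q /=.
    by move=> /horizontal_hyperplaneE ->; rewrite subrr.
  by move=> [_ /eqP]; rewrite subr_eq0 => /eqP /horizontal_hyperplaneE.
Qed.

Lemma tangent_horizontal_hyperplane (a : R) (q v : 'rV[R]_(n + 1)) :
  tangent (@horizontal_hyperplane R n a) q v -> v 0 last = 0.
Proof.
move=> [c [_ cS Dc]]; have [_ <-] := rV_is_derive last Dc.
apply: etrans (derive_cst a (0 : R) 1); apply: near_eq_derive.
by apply: filterS cS => t /horizontal_hyperplaneE.
Qed.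

Lemma weighted_minimal_horizontal_hyperplane (a : R) :
  weighted_minimal (@gauss_line_potential R n) (@horizontal_hyperplane R n a).
Proof.
split; first exact: hypersurface_horizontal_hyperplane.
move=> p _; pose N : 'rV[R]_(n + 1) := delta_mx 0 last.
have dotN w : dot N w = w 0 last.
  rewrite /dot (bigD1 last)//= mxE !eqxx mul1r big1 ?addr0// => i /negbTE ilast.
  by rewrite mxE ilast andbF mul0r.
exists setT, (cst N); split => //.
- exact: openT.
- split; first exact: smooth_cst.
  move=> q _ _; split; first by rewrite dotN mxE !eqxx.
  by move=> v /tangent_horizontal_hyperplane; rewrite dotN.
- rewrite /weighted_mean_curvature /mean_curvature /shape_operator.
  have -> : 'J (cst N) p = 0.
    by apply/matrixP => i j; rewrite [RHS]mxE mxE diff_cst /GRing.zero /Algebra.zero /= mxE.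
  rewrite oppr0 mulmx0 raddf0 add0r dot_grad_potential /ip big1// => i _.
  by rewrite !mxE eq_lrshift andbF mulr0.
Qed.

Lemma graph_eq_horizontal_hyperplane (u : 'rV[R]_n -> R) (a : R) :
  graph u = @horizontal_hyperplane R n a <-> forall x, u x = a.
Proof.
split=> [E x|ua].
  have : graph u (row_mx x (const_mx (u x))) by exists x.
  by rewrite E => /horizontal_hyperplaneE; rewrite row_mxEr mxE.
apply/seteqP; split=> [_ [x _ <-]|p /horizontal_hyperplaneE pa].
  by apply/horizontal_hyperplaneE; rewrite row_mxEr mxE.
exists (lsubmx p) => //; rewrite -[RHS]hsubmxK; congr row_mx.
by apply/matrixP => i j; rewrite !ord1 !mxE ua.
Qed.

End Hyperplane.

Theorem theorem4 (R : realType) (n : nat) (hn : (1 <= n)%N)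
    (u : 'rV[R]_n -> R) (hu : smooth_on setT u) :
  (weighted_minimal (@gauss_line_potential R n) (graph u) <->
   exists a : R, graph u = @horizontal_hyperplane R n a) /\
  (weighted_minimal (@gauss_line_potential R n) (graph u) <->
   exists a : R, forall x, u x = a).
Proof.
have flat : weighted_minimal (@gauss_line_potential R n) (graph u) <->
    exists a : R, forall x, u x = a.
  split=> [wm|[a /graph_eq_horizontal_hyperplane ->]].
    exact: (minimal_graph_constant hu (weighted_minimal_graph_equation hu wm)).
  exact: weighted_minimal_horizontal_hyperplane.
split=> //; rewrite flat.
by split=> -[a /graph_eq_horizontal_hyperplane ua]; exists a.
Qed.
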